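(* Let $(\mathcal{C},\otimes,1)$ and $(\mathcal{D},\otimes,1')$ be monoidal categories, both having coequalizers and with every object coflat. Assume that $1$ is a left $\otimes$-generator in $\mathcal{C}$. (a) Let $(F:\mathcal{C}\to\mathcal{D},\phi^2,\phi^0)$ be a lax monoidal functor and let $\varphi:R\to S$ be an algebra morphism in $\mathcal{C}$ such that $\varphi^*=-\otimes_R S:\mathcal{C}_R\to\mathcal{C}_S$ is semiseparable (resp., separable, naturally full). Then $F(\varphi)^*=-\otimes_{F(R)}F(S):\mathcal{D}_{F(R)}\to\mathcal{D}_{F(S)}$ is semiseparable (resp., separable, naturally full). (b) Conversely, suppose that $1'$ is a left $\otimes$-generator in $\mathcal{D}$ and that $(F:\mathcal{C}\to\mathcal{D},\phi^2,\phi^0)$ is a fully faithful lax monoidal functor such that $\phi^2$ is an epimorphism on components, and let $\varphi:R\to S$ be an algebra morphism in $\mathcal{C}$. If $F(\varphi)^*=-\otimes_{F(R)}F(S):\mathcal{D}_{F(R)}\to\mathcal{D}_{F(S)}$ is semiseparable (resp., separable, naturally full), then $\varphi^*=-\otimes_R S:\mathcal{C}_R\to\mathcal{C}_S$ is semiseparable (resp., separable, naturally full).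
   Context: Associativity and unit constraints are suppressed. For an algebra $A$ in a monoidal category $\mathcal{C}$, $m_A$ and $u_A$ are its multiplication and unit, and $\mathcal{C}_A$ (resp. ${}_A\mathcal{C}$) is the category of right (resp. left) $A$-modules in $\mathcal{C}$. An object $X$ is coflat if both $X\otimes-$ and $-\otimes X$ preserve coequalizers. For $M\in\mathcal{C}_A$ with action $\nu$ and $X\in{}_A\mathcal{C}$ with action $\mu$, $q^A_{M,X}:M\otimes X\to M\otimes_A X$ is the coequalizer of $\nu\otimes\mathrm{Id}_X$ and $\mathrm{Id}_M\otimes\mu$. For an algebra morphism $\varphi:R\to S$, $S$ is a left $R$-module via $m_S(\varphi\otimes\mathrm{Id}_S)$, and the induction functor $\varphi^*=-\otimes_R S:\mathcal{C}_R\to\mathcal{C}_S$ sends $X$ to $X\otimes_R S$ with right $S$-action induced by $m_S$, and $f:X\to Y$ to the unique morphism $f\otimes_R S$ with $(f\otimes_R S)q^R_{X,S}=q^R_{Y,S}(f\otimes\mathrm{Id}_S)$. A lax monoidal functor $(F,\phi^2,\phi^0)$ has structure maps $\phi^2_{X,Y}:F(X)\otimes F(Y)\to F(X\otimes Y)$ (natural) and $\phi^0:1'\to F(1)$ satisfying the usual associativity and unit axioms. It sends an algebra $(R,m_R,u_R)$ in $\mathcal{C}$ to the algebra $(F(R),F(m_R)\phi^2_{R,R},F(u_R)\phi^0)$ in $\mathcal{D}$ and algebra morphisms to algebra morphisms. An object $P$ is a left $\otimes$-generator of a monoidal category if for any morphisms $f,g:Y\otimes Z\to W$ with $f(\varepsilon\otimes\mathrm{Id}_Z)=g(\varepsilon\otimes\mathrm{Id}_Z)$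 for all $\varepsilon:P\to Y$, one has $f=g$. A functor $F:\mathcal{A}\to\mathcal{B}$ induces the natural transformation $\mathcal{F}:\mathrm{Hom}_{\mathcal{A}}(-,-)\to\mathrm{Hom}_{\mathcal{B}}(F-,F-)$, $f\mapsto F(f)$. $F$ is separable (resp. naturally full, semiseparable) if there is a natural transformation $\mathcal{P}:\mathrm{Hom}_{\mathcal{B}}(F-,F-)\to\mathrm{Hom}_{\mathcal{A}}(-,-)$ with $\mathcal{P}\circ\mathcal{F}=\mathrm{Id}$ (resp. $\mathcal{F}\circ\mathcal{P}=\mathrm{Id}$, $\mathcal{F}\circ\mathcal{P}\circ\mathcal{F}=\mathcal{F}$). *)

(* Defs.v *)
From Stdlib Require Import ssreflect ProofIrrelevance IndefiniteDescription.

Set Implicit Arguments.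
Unset Strict Implicit.
Unset Printing Implicit Defensive.

Declare Scope cat_scope.
Delimit Scope cat_scope with cat.
Local Open Scope cat_scope.

Record category := Category {
  obj :> Type;
  hom : obj -> obj -> Type;
  idm : forall X, hom X X;
  comp : forall X Y Z, hom Y Z -> hom X Y -> hom X Z;
  comp_assoc : forall X Y Z W (h : hom Z W) (g : hom Y Z) (f : hom X Y),
    comp (comp h g) f = comp h (comp g f);
  comp_idl : forall X Y (f : hom X Y), comp (idm Y) f = f;
  comp_idr : forall X Y (f : hom X Y), comp f (idm X) = f }.

Arguments hom {c} X Y.
Arguments idm {c} X.
Arguments comp {c X Y Z} g f.

Notation "g ∘ f" := (comp g f) (at level 40, left associativity) : cat_scope.

Record functor (A B : category) := Functor {
  fobj :> A -> B;
  fmap : forall X Y : A, hom X Y -> hom (fobj X) (fobj Y);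
  fmap_id : forall X, fmap (idm X) = idm (fobj X);
  fmap_comp : forall X Y Z (g : hom Y Z) (f : hom X Y),
    fmap (g ∘ f) = fmap g ∘ fmap f }.

Arguments fmap {A B} f0 {X Y} f.

Definition epi (C : category) (X Y : C) (e : hom X Y) : Prop :=
  forall Z (f g : hom Y Z), f ∘ e = g ∘ e -> f = g.

Definition faithful (A B : category) (F : functor A B) : Prop :=
  forall (X Y : A) (f g : hom X Y), fmap F f = fmap F g -> f = g.

Definition full (A B : category) (F : functor A B) : Prop :=
  forall (X Y : A) (g : hom (F X) (F Y)), exists f : hom X Y, fmap F f = g.

Definition fully_faithful (A B : category) (F : functor A B) : Prop :=
  full F /\ faithful F.

Section Separability.
Variables (A B : category) (F : functor A B).

(* Naturality of a family Hom_B(F-,F-) -> Hom_A(-,-), as functors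
   A^op * A -> Set. *)
Definition hom_natural
    (P : forall X Y : A, hom (F X) (F Y) -> hom X Y) : Prop :=
  forall (X X' Y Y' : A) (h : hom X' X) (k : hom Y Y') (f : hom (F X) (F Y)),
    P X' Y' (fmap F k ∘ f ∘ fmap F h) = k ∘ P X Y f ∘ h.

Definition separable : Prop :=
  exists P : forall X Y : A, hom (F X) (F Y) -> hom X Y,
    hom_natural P /\ forall (X Y : A) (f : hom X Y), P X Y (fmap F f) = f.

Definition naturally_full : Prop :=
  exists P : forall X Y : A, hom (F X) (F Y) -> hom X Y,
    hom_natural P /\
    forall (X Y : A) (g : hom (F X) (F Y)), fmap F (P X Y g) = g.

Definition semiseparable : Prop :=
  exists P : forall X Y : A, hom (F X) (F Y) -> hom X Y,
    hom_natural P /\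
    forall (X Y : A) (f : hom X Y), fmap F (P X Y (fmap F f)) = fmap F f.

End Separability.

Definition is_coequalizer (C : category) (X Y Q : C) (f g : hom X Y)
    (q : hom Y Q) : Prop :=
  q ∘ f = q ∘ g /\
  forall (W : C) (h : hom Y W), h ∘ f = h ∘ g -> exists! k : hom Q W, k ∘ q = h.

(* A choice of coequalizer for every parallel pair. *)
Record coequalizers (C : category) := Coequalizers {
  coeq_obj : forall X Y : C, hom X Y -> hom X Y -> C;
  coeq_map : forall (X Y : C) (f g : hom X Y), hom Y (coeq_obj f g);
  coeq_mapP : forall (X Y : C) (f g : hom X Y),
    is_coequalizer f g (coeq_map f g) }.

Definition preserves_coequalizers (A B : category) (F : functor A B) : Prop :=
  forall (X Y Q : A) (f g : hom X Y) (q : hom Y Q),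
    is_coequalizer f g q -> is_coequalizer (fmap F f) (fmap F g) (fmap F q).

Section CoequalizerDesc.
Variables (C : category) (X Y Q : C) (f g : hom X Y) (q : hom Y Q).
Hypothesis coeq_q : is_coequalizer f g q.

Lemma coeq_epi : epi q.
Proof.
move=> Z a b eq_ab; case: coeq_q => eq_q univ.
have eq_h : (b ∘ q) ∘ f = (b ∘ q) ∘ g by rewrite !comp_assoc eq_q.
case: (univ _ _ eq_h) => k [_ uniq_k].
by rewrite -(uniq_k _ eq_ab) -(uniq_k b).
Qed.

Lemma coeq_desc_sig (W : C) (h : hom Y W) :
  h ∘ f = h ∘ g -> {k : hom Q W | k ∘ q = h}.
Proof.
move=> eq_h; apply: constructive_indefinite_description.
by case: coeq_q => _ /(_ _ _ eq_h) [k [kq _]]; exists k.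
Qed.

Definition coeq_desc (W : C) (h : hom Y W) (eq_h : h ∘ f = h ∘ g) : hom Q W :=
  proj1_sig (coeq_desc_sig eq_h).

Lemma coeq_descE (W : C) (h : hom Y W) (eq_h : h ∘ f = h ∘ g) :
  coeq_desc eq_h ∘ q = h.
Proof. exact: (proj2_sig (coeq_desc_sig eq_h)). Qed.

End CoequalizerDesc.

Record monoidal_category := MonoidalCategory {
  mcat :> category;
  tens : mcat -> mcat -> mcat;
  tensh : forall X X' Y Y' : mcat,
    hom X X' -> hom Y Y' -> hom (tens X Y) (tens X' Y');
  tensh_id : forall X Y : mcat, tensh (idm X) (idm Y) = idm (tens X Y);
  tensh_comp : forall (X X' X'' Y Y' Y'' : mcat)
    (f' : hom X' X'') (f : hom X X') (g' : hom Y' Y'') (g : hom Y Y'),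
    tensh (f' ∘ f) (g' ∘ g) = tensh f' g' ∘ tensh f g;
  munit : mcat;
  assoc : forall X Y Z : mcat, hom (tens (tens X Y) Z) (tens X (tens Y Z));
  assoc_inv : forall X Y Z : mcat, hom (tens X (tens Y Z)) (tens (tens X Y) Z);
  assocK : forall X Y Z : mcat, assoc_inv X Y Z ∘ assoc X Y Z = idm _;
  assoc_invK : forall X Y Z : mcat, assoc X Y Z ∘ assoc_inv X Y Z = idm _;
  assoc_nat : forall (X X' Y Y' Z Z' : mcat)
    (f : hom X X') (g : hom Y Y') (h : hom Z Z'),
    assoc X' Y' Z' ∘ tensh (tensh f g) h = tensh f (tensh g h) ∘ assoc X Y Z;
  lunit : forall X : mcat, hom (tens munit X) X;
  lunit_inv : forall X : mcat, hom X (tens munit X);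
  lunitK : forall X : mcat, lunit_inv X ∘ lunit X = idm _;
  lunit_invK : forall X : mcat, lunit X ∘ lunit_inv X = idm _;
  lunit_nat : forall (X Y : mcat) (f : hom X Y),
    lunit Y ∘ tensh (idm munit) f = f ∘ lunit X;
  runit : forall X : mcat, hom (tens X munit) X;
  runit_inv : forall X : mcat, hom X (tens X munit);
  runitK : forall X : mcat, runit_inv X ∘ runit X = idm _;
  runit_invK : forall X : mcat, runit X ∘ runit_inv X = idm _;
  runit_nat : forall (X Y : mcat) (f : hom X Y),
    runit Y ∘ tensh f (idm munit) = f ∘ runit X;
  pentagon : forall X Y Z W : mcat,
    tensh (idm X) (assoc Y Z W) ∘ assoc X (tens Y Z) W
      ∘ tensh (assoc X Y Z) (idm W)
    = assoc X Y (tens Z W) ∘ assoc (tens X Y) Z W;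
  triangle : forall X Y : mcat,
    tensh (idm X) (lunit Y) ∘ assoc X munit Y = tensh (runit X) (idm Y) }.

Arguments tens {m} X Y.
Arguments tensh {m X X' Y Y'} f g.
Arguments munit m : clear implicits.
Arguments assoc {m} X Y Z.
Arguments assoc_inv {m} X Y Z.
Arguments lunit {m} X.
Arguments lunit_inv {m} X.
Arguments runit {m} X.
Arguments runit_inv {m} X.

Notation "X ⊗ Y" := (tens X Y) (at level 36, left associativity) : cat_scope.
Notation "f ⊠ g" := (tensh f g) (at level 36, left associativity) : cat_scope.

Section MonoidalTheory.
Variable C : monoidal_category.

Lemma tenshl_comp (X Y Z W : C) (g : hom Y Z) (f : hom X Y) :
  (g ∘ f) ⊠ idm W = (g ⊠ idm W) ∘ (f ⊠ idm W).
Proof. by rewrite -tensh_comp comp_idl. Qed.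

Lemma tenshr_comp (X Y Z W : C) (g : hom Y Z) (f : hom X Y) :
  idm W ⊠ (g ∘ f) = (idm W ⊠ g) ∘ (idm W ⊠ f).
Proof. by rewrite -tensh_comp comp_idl. Qed.

Lemma tensh_interchange (X X' Y Y' : C) (f : hom X X') (g : hom Y Y') :
  (idm X' ⊠ g) ∘ (f ⊠ idm Y) = (f ⊠ idm Y') ∘ (idm X ⊠ g).
Proof. by rewrite -!tensh_comp !comp_idl !comp_idr. Qed.

Definition tensor_left (X : C) : functor C C :=
  @Functor C C (fun Y => X ⊗ Y) (fun _ _ f => idm X ⊠ f)
    (fun Y => tensh_id X Y) (fun _ _ _ g f => tenshr_comp X g f).

Definition tensor_right (X : C) : functor C C :=
  @Functor C C (fun Y => Y ⊗ X) (fun _ _ f => f ⊠ idm X)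
    (fun Y => tensh_id Y X) (fun _ _ _ g f => tenshl_comp X g f).

Definition coflat (X : C) : Prop :=
  preserves_coequalizers (tensor_left X) /\
  preserves_coequalizers (tensor_right X).

Definition left_tensor_generator (P : C) : Prop :=
  forall (Y Z W : C) (f g : hom (Y ⊗ Z) W),
    (forall e : hom P Y, f ∘ (e ⊠ idm Z) = g ∘ (e ⊠ idm Z)) -> f = g.

Lemma assoc_mono (X Y Z W : C) (f g : hom W (X ⊗ Y ⊗ Z)) :
  assoc X Y Z ∘ f = assoc X Y Z ∘ g -> f = g.
Proof.
by move=> e; rewrite -(comp_idl f) -(comp_idl g) -assocK !comp_assoc e.
Qed.

Lemma tensor_unit_faithful (X Y : C) (f g : hom X Y) :
  f ⊠ idm (munit C) = g ⊠ idm (munit C) -> f = g.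
Proof.
move=> e; rewrite -(comp_idr f) -(comp_idr g) -runit_invK -!comp_assoc.
by rewrite -!runit_nat e.
Qed.

Lemma runit_tensor (X Y : C) :
  (idm X ⊠ runit Y) ∘ assoc X Y (munit C) = runit (X ⊗ Y).
Proof.
apply: tensor_unit_faithful; apply: assoc_mono.
rewrite -triangle -comp_assoc -tensh_id assoc_nat comp_assoc -pentagon.
rewrite tenshl_comp -[LHS]comp_assoc assoc_nat -triangle tenshr_comp.
by rewrite !comp_assoc.
Qed.

End MonoidalTheory.

Record algebra (C : monoidal_category) := Algebra {
  alg_obj :> C;
  alg_mul : hom (alg_obj ⊗ alg_obj) alg_obj;
  alg_one : hom (munit C) alg_obj;
  alg_mulA : alg_mul ∘ (alg_mul ⊠ idm alg_obj)
    = alg_mul ∘ (idm alg_obj ⊠ alg_mul) ∘ assoc alg_obj alg_obj alg_obj;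
  alg_mul1l : alg_mul ∘ (alg_one ⊠ idm alg_obj) = lunit alg_obj;
  alg_mul1r : alg_mul ∘ (idm alg_obj ⊠ alg_one) = runit alg_obj }.

Arguments alg_mul {C} a.
Arguments alg_one {C} a.

Record algebra_hom (C : monoidal_category) (R S : algebra C) := AlgebraHom {
  alg_hom :> hom R S;
  alg_hom_mul : alg_hom ∘ alg_mul R = alg_mul S ∘ (alg_hom ⊠ alg_hom);
  alg_hom_one : alg_hom ∘ alg_one R = alg_one S }.

Record right_module (C : monoidal_category) (A : algebra C) := RightModule {
  rmod_obj :> C;
  ract : hom (rmod_obj ⊗ A) rmod_obj;
  ractA : ract ∘ (ract ⊠ idm A)
    = ract ∘ (idm rmod_obj ⊠ alg_mul A) ∘ assoc rmod_obj A A;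
  ract1 : ract ∘ (idm rmod_obj ⊠ alg_one A) = runit rmod_obj }.

Arguments ract {C A} r.

Record left_module (C : monoidal_category) (A : algebra C) := LeftModule {
  lmod_obj :> C;
  lact : hom (A ⊗ lmod_obj) lmod_obj;
  lactA : lact ∘ (alg_mul A ⊠ idm lmod_obj)
    = lact ∘ (idm A ⊠ lact) ∘ assoc A A lmod_obj;
  lact1 : lact ∘ (alg_one A ⊠ idm lmod_obj) = lunit lmod_obj }.

Arguments lact {C A} l.

Record right_module_hom (C : monoidal_category) (A : algebra C)
    (M N : right_module A) := RightModuleHom {
  rmod_hom :> hom M N;
  rmod_hom_act : rmod_hom ∘ ract M = ract N ∘ (rmod_hom ⊠ idm A) }.

Section RightModules.
Variables (C : monoidal_category) (A : algebra C).

Lemma right_module_hom_eq (M N : right_module A) (f g : right_module_hom M N) :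
  rmod_hom f = rmod_hom g -> f = g.
Proof.
case: f g => f fP [g gP] /= eq_fg; subst g.
by rewrite (proof_irrelevance _ fP gP).
Qed.

Lemma right_module_id_act (M : right_module A) :
  idm M ∘ ract M = ract M ∘ (idm (M : C) ⊠ idm A).
Proof. by rewrite tensh_id comp_idl comp_idr. Qed.

Definition right_module_id (M : right_module A) : right_module_hom M M :=
  RightModuleHom (right_module_id_act M).

Lemma right_module_comp_act (M N L : right_module A)
    (g : right_module_hom N L) (f : right_module_hom M N) :
  (g ∘ f) ∘ ract M = ract L ∘ ((g ∘ f) ⊠ idm A).
Proof.
rewrite comp_assoc rmod_hom_act -comp_assoc rmod_hom_act tenshl_comp.
by rewrite comp_assoc.
Qed.

Definition right_module_comp (M N L : right_module A)
    (g : right_module_hom N L) (f : right_module_hom M N) :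
  right_module_hom M L := RightModuleHom (right_module_comp_act g f).

Definition right_modules : category.
Proof.
refine (@Category (right_module A) (@right_module_hom C A)
          right_module_id right_module_comp _ _ _) => *;
  apply: right_module_hom_eq.
- exact: comp_assoc.
- exact: comp_idl.
- exact: comp_idr.
Defined.

End RightModules.

Section TensorOver.
Variables (C : monoidal_category) (cq : coequalizers C) (A : algebra C).
Variables (M : right_module A) (X : left_module A).

Definition tensor_over_l : hom (M ⊗ A ⊗ X) (M ⊗ X) := ract M ⊠ idm (X : C).
Definition tensor_over_r : hom (M ⊗ A ⊗ X) (M ⊗ X) :=
  (idm (M : C) ⊠ lact X) ∘ assoc (M : C) A X.

Definition tensor_over : C := coeq_obj cq tensor_over_l tensor_over_r.

Definition tensor_over_map : hom (M ⊗ X) tensor_over :=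
  coeq_map cq tensor_over_l tensor_over_r.

Lemma tensor_over_mapP :
  is_coequalizer tensor_over_l tensor_over_r tensor_over_map.
Proof. exact: coeq_mapP. Qed.

End TensorOver.

Section RestrictedModule.
Variables (C : monoidal_category) (R S : algebra C) (phi : algebra_hom R S).

Definition restr_lact : hom (R ⊗ S) S := alg_mul S ∘ (phi ⊠ idm (S : C)).

Lemma restr_lactA :
  restr_lact ∘ (alg_mul R ⊠ idm (S : C))
  = restr_lact ∘ (idm (R : C) ⊠ restr_lact) ∘ assoc (R : C) R S.
Proof.
rewrite /restr_lact !comp_assoc -tensh_comp comp_idl alg_hom_mul.
rewrite tenshl_comp -comp_assoc alg_mulA !comp_assoc assoc_nat.
congr (_ ∘ _); rewrite -!comp_assoc -!tensh_comp.
by rewrite !comp_idl !comp_idr.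
Qed.

Lemma restr_lact1 :
  restr_lact ∘ (alg_one R ⊠ idm (S : C)) = lunit (S : C).
Proof.
by rewrite /restr_lact comp_assoc -tenshl_comp alg_hom_one alg_mul1l.
Qed.

Definition restr_left_module : left_module R :=
  LeftModule restr_lactA restr_lact1.

Lemma restr_lact_mul :
  alg_mul S ∘ (restr_lact ⊠ idm (S : C))
  = restr_lact ∘ (idm (R : C) ⊠ alg_mul S) ∘ assoc (R : C) S S.
Proof.
rewrite /restr_lact tenshl_comp -comp_assoc alg_mulA !comp_assoc assoc_nat.
congr (_ ∘ _); rewrite -!comp_assoc -!tensh_comp tensh_id.
by rewrite !comp_idl !comp_idr.
Qed.

End RestrictedModule.

Section Induction.
Variables (C : monoidal_category) (cq : coequalizers C).
Hypothesis cf : forall X : C, coflat X.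
Variables (R S : algebra C) (phi : algebra_hom R S).

Section OnObjects.
Variable X : right_module R.

Let q := tensor_over_map cq X (restr_left_module phi).

Definition induction_obj : C := tensor_over cq X (restr_left_module phi).

Lemma induction_mapS_coeq (Z : C) :
  is_coequalizer (tensor_over_l X (restr_left_module phi) ⊠ idm Z)
    (tensor_over_r X (restr_left_module phi) ⊠ idm Z) (q ⊠ idm Z).
Proof. by case: (cf Z) => _; apply; exact: tensor_over_mapP. Qed.

Lemma induction_act_subproof :
  q ∘ (idm (X : C) ⊠ alg_mul S) ∘ assoc (X : C) S S
    ∘ (tensor_over_l X (restr_left_module phi) ⊠ idm (S : C))
  = q ∘ (idm (X : C) ⊠ alg_mul S) ∘ assoc (X : C) S S
    ∘ (tensor_over_r X (restr_left_module phi) ⊠ idm (S : C)).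
Proof.
have [eq_q _] := tensor_over_mapP cq X (restr_left_module phi).
move: eq_q; rewrite -/q /tensor_over_l /tensor_over_r /= => eq_q.
rewrite !comp_assoc assoc_nat tensh_id -(comp_assoc (idm _ ⊠ _) (_ ⊠ idm _)).
rewrite tensh_interchange comp_assoc -(comp_assoc q) eq_q.
rewrite tenshl_comp -(comp_assoc (assoc _ _ _)) assoc_nat !comp_assoc.
congr (_ ∘ _).
rewrite -(comp_assoc (idm _ ⊠ alg_mul S)) -tenshr_comp restr_lact_mul.
move: (restr_lact phi) => l; rewrite !tenshr_comp !comp_assoc.
congr (_ ∘ _).
rewrite -(comp_assoc (_ ⊠ assoc _ _ _)) pentagon -tensh_id.
by rewrite -!comp_assoc assoc_nat.
Qed.

(* The right action induced by m_S on X ⊗_R S; its domain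
   (X ⊗_R S) ⊗ S is a coequalizer since S is coflat. *)
Definition induction_act : hom (induction_obj ⊗ S) induction_obj :=
  coeq_desc (induction_mapS_coeq S) induction_act_subproof.

Lemma induction_actE :
  induction_act ∘ (q ⊠ idm (S : C))
  = q ∘ (idm (X : C) ⊠ alg_mul S) ∘ assoc (X : C) S S.
Proof. exact: coeq_descE. Qed.

Lemma induction_actA :
  induction_act ∘ (induction_act ⊠ idm (S : C))
  = induction_act ∘ (idm induction_obj ⊠ alg_mul S)
      ∘ assoc induction_obj S S.
Proof.
have [_ /(_ _ _ _ _ _ _ (induction_mapS_coeq S)) qSS] := cf S.
apply: (coeq_epi qSS) => /=.
rewrite !comp_assoc -tenshl_comp induction_actE assoc_nat tensh_id.
rewrite -(comp_assoc (idm _ ⊠ _) (q ⊠ _)) tensh_interchange.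
rewrite -!(comp_assoc induction_act) induction_actE !tenshl_comp.
rewrite -!(comp_assoc induction_act) induction_actE !comp_assoc.
congr (_ ∘ _).
rewrite -(comp_assoc (assoc _ _ _) ((_ ⊠ _) ⊠ _)) assoc_nat.
rewrite -(tensh_id (X : C) S) -(comp_assoc (assoc _ _ _) ((_ ⊠ _) ⊠ _)).
rewrite -?comp_assoc -tenshr_comp alg_mulA !tenshr_comp.
rewrite !comp_assoc; congr (_ ∘ _).
rewrite -(comp_assoc (assoc _ _ _) (_ ⊠ _)) assoc_nat !comp_assoc.
by congr (_ ∘ _); rewrite -!comp_assoc pentagon.
Qed.

Lemma induction_act1 :
  induction_act ∘ (idm induction_obj ⊠ alg_one S) = runit induction_obj.
Proof.
apply: (coeq_epi (induction_mapS_coeq (munit C))).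
rewrite comp_assoc tensh_interchange -comp_assoc induction_actE runit_nat.
rewrite !comp_assoc; congr (_ ∘ _).
rewrite -tensh_id assoc_nat -comp_assoc -tenshr_comp alg_mul1r.
exact: runit_tensor.
Qed.

Definition induction_module : right_module S :=
  RightModule induction_actA induction_act1.

End OnObjects.

Section OnMorphisms.
Variables (X Y : right_module R) (f : right_module_hom X Y).

Let qX := tensor_over_map cq X (restr_left_module phi).
Let qY := tensor_over_map cq Y (restr_left_module phi).

Lemma induction_hom_subproof :
  qY ∘ (f ⊠ idm (S : C)) ∘ tensor_over_l X (restr_left_module phi)
  = qY ∘ (f ⊠ idm (S : C)) ∘ tensor_over_r X (restr_left_module phi).
Proof.
have [eq_q _] := tensor_over_mapP cq Y (restr_left_module phi).
move: eq_q; rewrite -/qY /tensor_over_l /tensor_over_r /= => eq_q.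
rewrite !comp_assoc -tenshl_comp rmod_hom_act tenshl_comp.
rewrite -(comp_assoc qY) eq_q !comp_assoc assoc_nat tensh_id.
by rewrite -(comp_assoc (_ ⊠ _) (_ ⊠ _)) tensh_interchange comp_assoc.
Qed.

Definition induction_mor : hom (induction_obj X) (induction_obj Y) :=
  coeq_desc (tensor_over_mapP cq X (restr_left_module phi))
    induction_hom_subproof.

Lemma induction_morE : induction_mor ∘ qX = qY ∘ (f ⊠ idm (S : C)).
Proof. exact: coeq_descE. Qed.

Lemma induction_mor_act :
  induction_mor ∘ induction_act X
  = induction_act Y ∘ (induction_mor ⊠ idm (S : C)).
Proof.
apply: (coeq_epi (induction_mapS_coeq X S)).
rewrite !comp_assoc induction_actE -tenshl_comp induction_morE tenshl_comp.
rewrite -(comp_assoc (induction_act Y)) induction_actE.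
rewrite -!(comp_assoc induction_mor) induction_morE !comp_assoc.
congr (_ ∘ _); rewrite assoc_nat tensh_id -!comp_assoc.
by rewrite tensh_interchange.
Qed.

Definition induction_hom :
    right_module_hom (induction_module X) (induction_module Y) :=
  @RightModuleHom C S (induction_module X) (induction_module Y)
    induction_mor induction_mor_act.

End OnMorphisms.

Definition induction : functor (right_modules R) (right_modules S).
Proof.
refine (@Functor (right_modules R) (right_modules S) induction_module
          induction_hom _ _).
- move=> X; apply: right_module_hom_eq => /=.
  apply: (coeq_epi (tensor_over_mapP cq X (restr_left_module phi))).
  by rewrite induction_morE /= tensh_id comp_idl comp_idr.
- move=> X Y Z g f; apply: right_module_hom_eq => /=.
  apply: (coeq_epi (tensor_over_mapP cq X (restr_left_module phi))).
  rewrite induction_morE comp_assoc induction_morE -comp_assoc.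
  by rewrite induction_morE comp_assoc -tenshl_comp.
Defined.

End Induction.

Record lax_monoidal_functor (C D : monoidal_category) := LaxMonoidalFunctor {
  lax_functor :> functor C D;
  lax2 : forall X Y : C,
    hom (lax_functor X ⊗ lax_functor Y) (lax_functor (X ⊗ Y));
  lax0 : hom (munit D) (lax_functor (munit C));
  lax2_nat : forall (X X' Y Y' : C) (f : hom X X') (g : hom Y Y'),
    lax2 X' Y' ∘ (fmap lax_functor f ⊠ fmap lax_functor g)
    = fmap lax_functor (f ⊠ g) ∘ lax2 X Y;
  lax_assoc : forall X Y Z : C,
    fmap lax_functor (assoc X Y Z) ∘ lax2 (X ⊗ Y) Z
      ∘ (lax2 X Y ⊠ idm (lax_functor Z))
    = lax2 X (Y ⊗ Z) ∘ (idm (lax_functor X) ⊠ lax2 Y Z)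
      ∘ assoc (lax_functor X) (lax_functor Y) (lax_functor Z);
  lax_lunit : forall X : C,
    fmap lax_functor (lunit X) ∘ lax2 (munit C) X
      ∘ (lax0 ⊠ idm (lax_functor X))
    = lunit (lax_functor X);
  lax_runit : forall X : C,
    fmap lax_functor (runit X) ∘ lax2 X (munit C)
      ∘ (idm (lax_functor X) ⊠ lax0)
    = runit (lax_functor X) }.

Arguments lax2 {C D} l X Y.
Arguments lax0 {C D} l.

Section LaxImage.
Variables (C D : monoidal_category) (F : lax_monoidal_functor C D).

Section Algebra.
Variable R : algebra C.

Definition lax_mul : hom (F R ⊗ F R) (F R) :=
  fmap F (alg_mul R) ∘ lax2 F R R.
Definition lax_one : hom (munit D) (F R) := fmap F (alg_one R) ∘ lax0 F.

Lemma lax_mulA :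
  lax_mul ∘ (lax_mul ⊠ idm (F R))
  = lax_mul ∘ (idm (F R) ⊠ lax_mul) ∘ assoc (F R) (F R) (F R).
Proof.
rewrite /lax_mul tenshl_comp tenshr_comp -(fmap_id F R) !comp_assoc.
rewrite -!(comp_assoc (lax2 F R R)) !lax2_nat !comp_assoc.
rewrite -!(comp_assoc (fmap F (alg_mul R))) -!fmap_comp alg_mulA.
rewrite fmap_comp !fmap_id !comp_assoc; congr (_ ∘ _).
by rewrite -!comp_assoc lax_assoc.
Qed.

Lemma lax_mul1l : lax_mul ∘ (lax_one ⊠ idm (F R)) = lunit (F R).
Proof.
rewrite /lax_mul /lax_one tenshl_comp -lax_lunit -alg_mul1l fmap_comp.
rewrite -{1}(fmap_id F R) !comp_assoc; congr (_ ∘ _).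
by rewrite -!comp_assoc lax2_nat.
Qed.

Lemma lax_mul1r : lax_mul ∘ (idm (F R) ⊠ lax_one) = runit (F R).
Proof.
rewrite /lax_mul /lax_one tenshr_comp -lax_runit -alg_mul1r fmap_comp.
rewrite -{1}(fmap_id F R) !comp_assoc; congr (_ ∘ _).
by rewrite -!comp_assoc lax2_nat.
Qed.

Definition lax_algebra : algebra D := Algebra lax_mulA lax_mul1l lax_mul1r.

End Algebra.

Variables (R S : algebra C) (phi : algebra_hom R S).

Lemma lax_hom_mul :
  fmap F phi ∘ alg_mul (lax_algebra R)
  = alg_mul (lax_algebra S) ∘ (fmap F phi ⊠ fmap F phi).
Proof.
rewrite /= /lax_mul comp_assoc lax2_nat -!comp_assoc -!fmap_comp.
by rewrite alg_hom_mul.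
Qed.

Lemma lax_hom_one :
  fmap F phi ∘ alg_one (lax_algebra R) = alg_one (lax_algebra S).
Proof. by rewrite /= /lax_one -comp_assoc -fmap_comp alg_hom_one. Qed.

Definition lax_algebra_hom : algebra_hom (lax_algebra R) (lax_algebra S) :=
  @AlgebraHom D (lax_algebra R) (lax_algebra S) (fmap F phi)
    lax_hom_mul lax_hom_one.

End LaxImage.

(* Main.v *)
(** Under the tensor generator hypothesis, semiseparability (resp. separability,
    natural fullness) of [φ^*] amounts to the existence of an [R]-bimodule map
    [E : S -> R] with [φ E φ = φ] (resp. [E φ = id], [φ E = id]).
    Given the natural family [P], [E] is the image under [P] of
    [S ⊗_R S -> R ⊗_R S, s ⊗ s' ↦ 1 ⊗ s s'].  Naturality makes [E] commute with
    left multiplication by every [1 -> R], hence left linear by the generator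
    property.  Conversely, [E] gives the natural maps
    [X ⊗_R S -> X, x ⊗ s ↦ x E(s)], and [P] composes with these and with
    [x ↦ x ⊗ 1].  Such an [E] is carried along by [F], and reflected when [F] is
    fully faithful with epimorphic [φ^2]. *)

From Stdlib Require Import ssreflect.
Require Import Defs.

Set Implicit Arguments.
Unset Strict Implicit.
Unset Printing Implicit Defensive.

Local Open Scope cat_scope.

(** Composites are kept nested to the right, where the left side of [e] is not a subterm of a longer
    chain; this form makes [e] usable for rewriting there. *)
Lemma comp_cong_r (C : category) (X Y Y' Z W : C) (g : hom Y Z) (f : hom X Y)
    (g' : hom Y' Z) (f' : hom X Y') (e : g ∘ f = g' ∘ f') (k : hom W X) :
  g ∘ (f ∘ k) = g' ∘ (f' ∘ k).
Proof. by rewrite -!comp_assoc e. Qed.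

Lemma comp_inv_epi (C : category) (X Y : C) (e : hom X Y) (e' : hom Y X) :
  e ∘ e' = idm Y -> epi e.
Proof.
by move=> ee' Z f g fg; rewrite -(comp_idr f) -(comp_idr g) -ee' -!comp_assoc fg.
Qed.

(** * Naturality in one variable at a time *)

Section HomNatural.
Variables (A B : category) (F : functor A B).
Variable P : forall X Y : A, hom (F X) (F Y) -> hom X Y.
Hypothesis natP : hom_natural P.

(** The other variable is held at an identity. The composite need only be provably equal to [g], so
    it can be supplied in simplified form. *)
Lemma hom_natural_l (X' X Y : A) (h : hom X' X) (f : hom (F X) (F Y)) (g : hom (F X') (F Y)) :
  f ∘ fmap F h = g -> P f ∘ h = P g.
Proof.
by move=> <-; have := natP h (idm Y) f; rewrite fmap_id !comp_idl => ->.
Qed.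

Lemma hom_natural_r (X Y Y' : A) (k : hom Y Y') (f : hom (F X) (F Y)) (g : hom (F X) (F Y')) :
  fmap F k ∘ f = g -> k ∘ P f = P g.
Proof.
by move=> <-; have := natP (idm X) k f; rewrite fmap_id !comp_idr => ->.
Qed.

End HomNatural.

(** * Coherence consequences of the pentagon and triangle axioms *)

Section Whiskering.
Variable C : monoidal_category.

Lemma assoc_nat_l (X X' Y Z : C) (f : hom X X') :
  assoc X' Y Z ∘ (f ⊠ idm Y ⊠ idm Z) = (f ⊠ idm (Y ⊗ Z)) ∘ assoc X Y Z.
Proof. by rewrite assoc_nat tensh_id. Qed.

Lemma assoc_nat_r (X Y Z Z' : C) (h : hom Z Z') :
  assoc X Y Z' ∘ (idm (X ⊗ Y) ⊠ h) = (idm X ⊠ (idm Y ⊠ h)) ∘ assoc X Y Z.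
Proof. by rewrite -tensh_id assoc_nat. Qed.

Lemma tensor_unit_faithful_l (X Y : C) (f g : hom X Y) :
  idm (munit C) ⊠ f = idm (munit C) ⊠ g -> f = g.
Proof.
move=> e; apply: (comp_inv_epi (lunit_invK X)).
by rewrite -!lunit_nat e.
Qed.

(** Kelly's argument: tensor with the unit on the left, precompose with associators, then combine
    the pentagon at 1, 1, X, Y with the triangle. *)
Lemma lunit_tensor (X Y : C) :
  lunit (X ⊗ Y) ∘ assoc (munit C) X Y = lunit X ⊠ idm Y.
Proof.
apply: tensor_unit_faithful_l.
apply: (comp_inv_epi (assoc_invK (munit C) (munit C ⊗ X) Y)).
have e : assoc (munit C) (munit C) X ⊠ idm Y
    ∘ (assoc_inv (munit C) (munit C) X ⊠ idm Y) = idm _.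
  by rewrite -tenshl_comp assoc_invK tensh_id.
apply: (comp_inv_epi e).
rewrite tenshr_comp !comp_assoc -(comp_assoc (idm _ ⊠ assoc _ _ _)) pentagon.
rewrite -comp_assoc triangle -assoc_nat_l -triangle tenshl_comp.
by rewrite -comp_assoc assoc_nat comp_assoc.
Qed.

Lemma lunit_inv_tensor (X Y : C) :
  assoc (munit C) X Y ∘ (lunit_inv X ⊠ idm Y) = lunit_inv (X ⊗ Y).
Proof.
rewrite -[LHS]comp_idl -lunitK comp_assoc -(comp_assoc (lunit _)) lunit_tensor.
by rewrite -tenshl_comp lunit_invK tensh_id comp_idr.
Qed.

Lemma lunit_inv_nat (X Y : C) (f : hom X Y) :
  lunit_inv Y ∘ f = (idm (munit C) ⊠ f) ∘ lunit_inv X.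
Proof.
apply: (comp_inv_epi (lunit_invK X)).
by rewrite !comp_assoc lunitK comp_idr -lunit_nat -comp_assoc lunitK comp_idl.
Qed.

Lemma runit_inv_nat (X Y : C) (f : hom X Y) :
  runit_inv Y ∘ f = (f ⊠ idm (munit C)) ∘ runit_inv X.
Proof.
apply: (comp_inv_epi (runit_invK X)).
by rewrite !comp_assoc runitK comp_idr -runit_nat -comp_assoc runitK comp_idl.
Qed.

Lemma runit_inv_triangle (X Y : C) :
  assoc X (munit C) Y ∘ (runit_inv X ⊠ idm Y) = idm X ⊠ lunit_inv Y.
Proof.
have e : (idm X ⊠ lunit_inv Y) ∘ (idm X ⊠ lunit Y) = idm _.
  by rewrite -tenshr_comp lunitK tensh_id.
rewrite -[LHS]comp_idl -e comp_assoc -(comp_assoc (_ ⊠ lunit _)) triangle.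
by rewrite -tenshl_comp runit_invK tensh_id comp_idr.
Qed.

Lemma runit_inv_tensor (X Y : C) :
  assoc X Y (munit C) ∘ runit_inv (X ⊗ Y) = idm X ⊠ runit_inv Y.
Proof.
have e : (idm X ⊠ runit_inv Y) ∘ (idm X ⊠ runit Y) = idm _.
  by rewrite -tenshr_comp runitK tensh_id.
rewrite -[LHS]comp_idl -e comp_assoc -(comp_assoc (_ ⊠ runit _)) runit_tensor.
by rewrite runit_invK comp_idr.
Qed.

End Whiskering.

(** * [R] and [S] as right [R]-modules, and left multiplications *)

Section Modules.
Variable C : monoidal_category.

Definition regular_module (R : algebra C) : right_module R :=
  @RightModule C R R (alg_mul R) (alg_mulA R) (alg_mul1r R).

Variables (R S : algebra C) (phi : algebra_hom R S).

Lemma restriction_actA :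
  alg_mul S ∘ (idm (S : C) ⊠ phi) ∘ ((alg_mul S ∘ (idm (S : C) ⊠ phi)) ⊠ idm (R : C))
  = alg_mul S ∘ (idm (S : C) ⊠ phi) ∘ (idm (S : C) ⊠ alg_mul R) ∘ assoc (S : C) R R.
Proof.
rewrite !comp_assoc -(comp_assoc (idm _ ⊠ phi)) -tenshr_comp alg_hom_mul tenshr_comp.
rewrite !comp_assoc -assoc_nat tenshl_comp (comp_cong_r (tensh_interchange _ _)).
rewrite -(comp_assoc (alg_mul S)) alg_mulA !comp_assoc; congr (_ ∘ (_ ∘ (_ ∘ _))).
by rewrite -tensh_comp comp_idr comp_idl.
Qed.

Lemma restriction_act1 :
  alg_mul S ∘ (idm (S : C) ⊠ phi) ∘ (idm (S : C) ⊠ alg_one R) = runit (S : C).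
Proof. by rewrite comp_assoc -tenshr_comp alg_hom_one alg_mul1r. Qed.

Definition restriction_regular : right_module R :=
  RightModule restriction_actA restriction_act1.

Lemma alg_hom_act :
  phi ∘ ract (regular_module R)
  = ract restriction_regular ∘ (phi ⊠ idm (R : C)).
Proof. by rewrite /= alg_hom_mul comp_assoc tensh_interchange -tensh_comp comp_idl comp_idr. Qed.

Definition alg_hom_module : right_module_hom (regular_module R) restriction_regular :=
  @RightModuleHom C R (regular_module R) restriction_regular phi alg_hom_act.

(** The map a ↦ e a for a global element [e]. It turns the test maps of the generator property into
    module endomorphisms, to which naturality applies. *)
Definition lmul (A : algebra C) (e : hom (munit C) A) : hom A A :=
  alg_mul A ∘ (e ⊠ idm (A : C)) ∘ lunit_inv (A : C).

Lemma lmul_mul (A : algebra C) (e : hom (munit C) A) :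
  lmul e ∘ alg_mul A = alg_mul A ∘ (lmul e ⊠ idm (A : C)).
Proof.
rewrite /lmul !tenshl_comp !comp_assoc lunit_inv_nat -(comp_assoc (alg_mul A) (alg_mul A ⊠ _)).
rewrite alg_mulA !comp_assoc; congr (_ ∘ _).
rewrite (comp_cong_r (assoc_nat_l _ _ _)) lunit_inv_tensor.
by rewrite (comp_cong_r (tensh_interchange _ _)).
Qed.

Lemma lmul_regular_act (e : hom (munit C) R) :
  lmul e ∘ ract (regular_module R) = ract (regular_module R) ∘ (lmul e ⊠ idm (R : C)).
Proof. exact: lmul_mul. Qed.

Lemma lmul_restriction_act (e : hom (munit C) S) :
  lmul e ∘ ract restriction_regular
  = ract restriction_regular ∘ (lmul e ⊠ idm (R : C)).
Proof. by rewrite /= -comp_assoc lmul_mul !comp_assoc tensh_interchange. Qed.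

Lemma lmul_alg_hom (e : hom (munit C) R) : phi ∘ lmul e = lmul (phi ∘ e) ∘ phi.
Proof.
rewrite /lmul -!comp_assoc alg_hom_mul !comp_assoc lunit_inv_nat.
by congr (_ ∘ _); rewrite -!comp_assoc -!tensh_comp !comp_idl !comp_idr.
Qed.

Lemma lmul_restr_lact (e : hom (munit C) R) :
  restr_lact phi ∘ (lmul e ⊠ idm (S : C)) = lmul (phi ∘ e) ∘ restr_lact phi.
Proof.
rewrite /restr_lact comp_assoc -tenshl_comp lmul_alg_hom tenshl_comp.
by rewrite -comp_assoc -lmul_mul comp_assoc.
Qed.

Definition lmul_regular e : right_module_hom (regular_module R) (regular_module R) :=
  @RightModuleHom C R (regular_module R) (regular_module R) (lmul e) (lmul_regular_act e).

Definition lmul_restriction e : right_module_hom restriction_regular restriction_regular :=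
  @RightModuleHom C R restriction_regular restriction_regular (lmul e)
    (lmul_restriction_act e).

(** Linearity is an equation on a bare morphism of [C], not a bundled bimodule map, so that [fmap F]
    can act on the morphism directly. *)
Definition left_linear (E : hom S R) : Prop :=
  E ∘ restr_lact phi = alg_mul R ∘ (idm (R : C) ⊠ E).

Definition right_linear (E : hom S R) : Prop :=
  E ∘ (alg_mul S ∘ (idm (S : C) ⊠ phi)) = alg_mul R ∘ (E ⊠ idm (R : C)).

End Modules.

(** * The modules X ⊗_R S and the isomorphism R ⊗_R S ≅ S *)

Section InductionTheory.
Variables (C : monoidal_category) (cq : coequalizers C).
Hypothesis cf : forall X : C, coflat X.
Variables (R S : algebra C) (phi : algebra_hom R S).

Let q (X : right_module R) := tensor_over_map cq X (restr_left_module phi).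
Let act (X : right_module R) := induction_act cq cf phi X.
Let ind := induction cq cf phi.

Lemma ind_map_epi (X : right_module R) : epi (q X).
Proof. exact: (coeq_epi (tensor_over_mapP cq X (restr_left_module phi))). Qed.

Lemma ind_mapS_epi (X : right_module R) (Z : C) : epi (q X ⊠ idm Z).
Proof. exact: (coeq_epi (induction_mapS_coeq cq cf phi X Z)). Qed.

Lemma ind_map_balanced (X : right_module R) :
  q X ∘ (ract X ⊠ idm (S : C))
  = q X ∘ ((idm (X : C) ⊠ restr_lact phi) ∘ assoc (X : C) R S).
Proof. by case: (tensor_over_mapP cq X (restr_left_module phi)). Qed.

Lemma ind_fmapE (X Y : right_module R) (f : right_module_hom X Y) :
  rmod_hom (fmap ind f) ∘ q X = q Y ∘ (f ⊠ idm (S : C)).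
Proof. exact: induction_morE. Qed.

Lemma ind_actE (X : right_module R) :
  act X ∘ (q X ⊠ idm (S : C)) = q X ∘ ((idm (X : C) ⊠ alg_mul S) ∘ assoc (X : C) S S).
Proof. by rewrite /act induction_actE comp_assoc. Qed.

(** The map s ↦ 1 ⊗ s, inverse to the canonical isomorphism R ⊗_R S -> S. *)
Definition ind_regular_inv : hom S (induction_obj cq phi (regular_module R)) :=
  q (regular_module R) ∘ (alg_one R ⊠ idm (S : C)) ∘ lunit_inv (S : C).

Lemma restr_lact_one : restr_lact phi ∘ (alg_one R ⊠ idm (S : C)) ∘ lunit_inv (S : C) = idm (S : C).
Proof. by rewrite restr_lact1 lunit_invK. Qed.

(** In elements, r ⊗ s = 1r ⊗ s = 1 ⊗ φ(r)s by the coequalizer relation. *)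
Lemma ind_regular_map : q (regular_module R) = ind_regular_inv ∘ restr_lact phi.
Proof.
rewrite /ind_regular_inv !comp_assoc lunit_inv_nat -lunit_inv_tensor.
rewrite (comp_cong_r (eq_sym (tensh_interchange _ _))).
rewrite (comp_cong_r (eq_sym (assoc_nat_l _ _ _))) -tenshl_comp.
rewrite -(comp_assoc (idm _ ⊠ _)) (comp_cong_r (eq_sym (ind_map_balanced (regular_module R)))).
rewrite -tenshl_comp -comp_assoc /= alg_mul1l lunit_invK tensh_id.
by rewrite comp_idr.
Qed.

(** The action [restr_lact phi] descends to R ⊗_R S, and the induced map [k] is a left inverse
    because φ(1)s = s. *)
Lemma ind_regular_inv_mono (Z : C) (f g : hom Z S) :
  ind_regular_inv ∘ f = ind_regular_inv ∘ g -> f = g.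
Proof.
have e : restr_lact phi ∘ tensor_over_l (regular_module R) (restr_left_module phi)
       = restr_lact phi ∘ tensor_over_r (regular_module R) (restr_left_module phi).
  by rewrite -[RHS]comp_assoc; exact: restr_lactA.
have [k [kq _]] := proj2 (tensor_over_mapP cq (regular_module R) (restr_left_module phi)) _ _ e.
have kK : (k : hom (induction_obj cq phi _) _) ∘ ind_regular_inv = idm (S : C).
  by rewrite /ind_regular_inv -!comp_assoc kq restr_lact_one.
by move=> efg; rewrite -(comp_idl f) -(comp_idl g) -kK 2!(comp_assoc k) efg.
Qed.

Lemma ind_regular_inv_act :
  ind_regular_inv ∘ alg_mul S = act (regular_module R) ∘ (ind_regular_inv ⊠ idm (S : C)).
Proof.
rewrite /ind_regular_inv !tenshl_comp !comp_assoc -(comp_assoc (act _)) ind_actE.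
rewrite !comp_assoc (comp_cong_r (assoc_nat_l _ _ _)) lunit_inv_tensor lunit_inv_nat.
by rewrite (comp_cong_r (tensh_interchange _ _)).
Qed.

Lemma ind_mul_balanced :
  (ind_regular_inv ∘ alg_mul S)
    ∘ tensor_over_l (restriction_regular phi) (restr_left_module phi)
  = (ind_regular_inv ∘ alg_mul S)
    ∘ tensor_over_r (restriction_regular phi) (restr_left_module phi).
Proof.
rewrite /tensor_over_l /tensor_over_r /= !(comp_assoc ind_regular_inv).
congr (_ ∘ _).
rewrite tenshl_comp -comp_assoc alg_mulA !comp_assoc assoc_nat /restr_lact.
by rewrite tenshr_comp !comp_assoc.
Qed.

(* The counit of the induction/restriction adjunction at [S], seen through the isomorphism [R ⊗_R S ≅ S]. *)
Definition ind_mul_obj :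
    hom (induction_obj cq phi (restriction_regular phi))
        (induction_obj cq phi (regular_module R)) :=
  coeq_desc (tensor_over_mapP cq (restriction_regular phi) (restr_left_module phi))
    ind_mul_balanced.

Lemma ind_mul_objE :
  ind_mul_obj ∘ q (restriction_regular phi) = ind_regular_inv ∘ alg_mul S.
Proof. exact: coeq_descE. Qed.

Lemma ind_mul_act :
  ind_mul_obj ∘ act (restriction_regular phi)
  = act (regular_module R) ∘ (ind_mul_obj ⊠ idm (S : C)).
Proof.
apply: (ind_mapS_epi (X := restriction_regular phi)).
rewrite !comp_assoc -tenshl_comp ind_mul_objE ind_actE tenshl_comp.
rewrite (comp_cong_r ind_mul_objE) -(comp_assoc (act _)) -ind_regular_inv_act.
by rewrite !(comp_assoc ind_regular_inv) alg_mulA comp_assoc.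
Qed.

(** A natural family [P] accepts only morphisms between induced modules, hence the target R ⊗_R S in
    place of [S]. *)
Definition ind_mul :
    right_module_hom (ind (restriction_regular phi)) (ind (regular_module R)) :=
  @RightModuleHom C S (ind (restriction_regular phi)) (ind (regular_module R))
    ind_mul_obj ind_mul_act.

(** In elements, r ⊗ s ↦ φ(r) ⊗ s ↦ 1 ⊗ φ(r)s = r ⊗ s. *)
Lemma ind_mul_alg_hom :
  rmod_hom ind_mul ∘ rmod_hom (fmap ind (alg_hom_module phi)) = idm _.
Proof.
apply: (ind_map_epi (X := regular_module R)).
by rewrite comp_assoc ind_fmapE -comp_assoc ind_mul_objE comp_idl ind_regular_map comp_assoc.
Qed.

Lemma ind_regular_inv_lmul (e : hom (munit C) R) :
  rmod_hom (fmap ind (lmul_regular e)) ∘ ind_regular_inv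
  = ind_regular_inv ∘ lmul (phi ∘ e).
Proof.
rewrite {1}/ind_regular_inv -!(comp_assoc (rmod_hom _)) ind_fmapE ind_regular_map /=.
rewrite !(comp_assoc ind_regular_inv) lmul_restr_lact.
by rewrite !(comp_assoc (lmul _)) restr_lact_one comp_idr.
Qed.

(** Both composites send s ⊗ s' to 1 ⊗ φ(e)ss'. Naturality of [P] later converts this into
    compatibility of [splitting] with left multiplications. *)
Lemma ind_mul_lmul (e : hom (munit C) R) :
  rmod_hom (fmap ind (lmul_regular e)) ∘ rmod_hom ind_mul
  = rmod_hom ind_mul ∘ rmod_hom (fmap ind (lmul_restriction phi (phi ∘ e))).
Proof.
apply: (ind_map_epi (X := restriction_regular phi)).
rewrite !comp_assoc ind_fmapE -[RHS]comp_assoc ind_mul_objE /=.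
rewrite -(comp_assoc (induction_mor _ _ _)) ind_regular_inv_lmul.
by rewrite !(comp_assoc ind_regular_inv) lmul_mul.
Qed.

(** An element of [S] is recovered from its left multiplication by evaluating at s = 1. *)
Lemma restr_lact_inj (X : C) (f : hom X R) (g : hom X S) :
  restr_lact phi ∘ (f ⊠ idm (S : C)) = alg_mul S ∘ (g ⊠ idm (S : C)) -> phi ∘ f = g.
Proof.
move=> /(f_equal (fun h => h ∘ (idm X ⊠ alg_one S))).
rewrite /restr_lact (comp_assoc _ _ (f ⊠ _)) -tenshl_comp !comp_assoc.
rewrite -!tensh_interchange -!(comp_assoc (alg_mul S)) alg_mul1r !runit_nat.
exact: (comp_inv_epi (runit_invK X)).
Qed.

(** * From a natural family [P] to the bimodule map *)

Section FromFunctor.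
Hypothesis gen : left_tensor_generator (munit C).
Variable P : forall X Y : right_modules R, hom (ind X) (ind Y) -> hom X Y.
Hypothesis natP : hom_natural P.

Definition splitting : right_module_hom (restriction_regular phi) (regular_module R) :=
  P (ind_mul : hom (ind (restriction_regular phi)) (ind (regular_module R))).

(** [P] takes values in right [R]-module morphisms, and the action on [restriction_regular] is the
    one appearing in [right_linear]. *)
Lemma splitting_right_linear : right_linear phi splitting.
Proof. exact: (rmod_hom_act splitting). Qed.

(** Naturality in the source and in the target writes the two sides as values of [P] at the two
    composites of [ind_mul_lmul], which agree. *)
Lemma splitting_lmul (e : hom (munit C) R) :
  splitting ∘ lmul (phi ∘ e) = lmul e ∘ splitting.
Proof.
pose f : hom (ind (restriction_regular phi)) (ind (regular_module R)) := ind_mul.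
have nat_l := hom_natural_l natP (h := lmul_restriction phi (phi ∘ e)) (f := f) eq_refl.
have nat_r := hom_natural_r natP (k := lmul_regular e) (f := f) eq_refl.
have ff : fmap ind (lmul_regular e) ∘ f = f ∘ fmap ind (lmul_restriction phi (phi ∘ e)).
  by apply: right_module_hom_eq; exact: ind_mul_lmul.
rewrite ff -nat_l in nat_r.
exact: (eq_sym (f_equal (@rmod_hom _ _ _ _) nat_r)).
Qed.

Lemma splitting_left_linear : left_linear phi splitting.
Proof.
(* [gen] reduces the claim to tests against each [e : 1 -> R]; precomposing with the epimorphism
   [lunit_inv S] makes left multiplications by φ(e) and [e] appear. *)
apply: gen => e; apply: (comp_inv_epi (lunitK (S : C))).
have -> : splitting ∘ restr_lact phi ∘ (e ⊠ idm (S : C)) ∘ lunit_inv (S : C)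
    = splitting ∘ lmul (phi ∘ e).
  by rewrite /lmul /restr_lact tenshl_comp !comp_assoc.
rewrite splitting_lmul /lmul !comp_assoc lunit_inv_nat.
by rewrite (comp_cong_r (tensh_interchange _ _)).
Qed.

(** Naturality moves [phi] inside [P], where [ind_mul_alg_hom] cancels it. The identity is written
    as [fmap ind] of an identity, the form to which the conditions on [P] apply. *)
Lemma splitting_alg_hom :
  splitting ∘ phi = rmod_hom (P (fmap ind (idm (regular_module R : right_modules R)))).
Proof.
pose f : hom (ind (restriction_regular phi)) (ind (regular_module R)) := ind_mul.
have ff : f ∘ fmap ind (alg_hom_module phi) = fmap ind (idm (regular_module R : right_modules R)).
  by rewrite fmap_id; apply: right_module_hom_eq; exact: ind_mul_alg_hom.
exact: (f_equal (@rmod_hom _ _ _ _) (hom_natural_l natP ff)).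
Qed.

Lemma splitting_retraction :
  (forall (X Y : right_modules R) (f : hom X Y), P (fmap ind f) = f) ->
  splitting ∘ phi = idm (R : C).
Proof. by move=> PK; rewrite splitting_alg_hom PK. Qed.

(** The map E φ = P(id) induces the identity of R ⊗_R S, so 1 ⊗ φ(E(φ(r)))s = 1 ⊗ φ(r)s; cancel 1 ⊗
    - and put s = 1. *)
Lemma splitting_weak :
  (forall (X Y : right_modules R) (f : hom X Y),
     fmap ind (P (fmap ind f)) = fmap ind f) ->
  phi ∘ splitting ∘ phi = phi.
Proof.
move=> PK; rewrite comp_assoc splitting_alg_hom; apply: restr_lact_inj.
apply: ind_regular_inv_mono; rewrite -[LHS]comp_assoc -ind_regular_map.
rewrite -(ind_fmapE (X := regular_module R) (Y := regular_module R)).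
by rewrite PK fmap_id comp_idl ind_regular_map.
Qed.

(** Here E induces [ind_mul] itself, so 1 ⊗ φ(E(s))s' = 1 ⊗ ss'; cancel 1 ⊗ - and put s' = 1. *)
Lemma splitting_section :
  (forall (X Y : right_modules R) (g : hom (ind X) (ind Y)), fmap ind (P g) = g) ->
  phi ∘ splitting = idm (S : C).
Proof.
move=> PK; apply: restr_lact_inj.
apply: ind_regular_inv_mono; rewrite -[LHS]comp_assoc -ind_regular_map.
rewrite -(ind_fmapE (X := restriction_regular phi) (Y := regular_module R)).
by rewrite PK ind_mul_objE tensh_id comp_idr.
Qed.

End FromFunctor.

(** * The unit x ↦ x ⊗ 1, and the natural family built from [E] *)

Definition ind_unit (X : right_module R) : hom X (induction_obj cq phi X) :=
  q X ∘ (idm (X : C) ⊠ alg_one S) ∘ runit_inv (X : C).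

(** In elements, (x ⊗ 1)s = x ⊗ s. Hence an [S]-linear map out of X ⊗_R S is determined by its
    composite with [ind_unit]. *)
Lemma ind_act_unit (X : right_module R) :
  act X ∘ (ind_unit X ⊠ idm (S : C)) = q X.
Proof.
rewrite /ind_unit !tenshl_comp -!comp_assoc ind_actE !comp_assoc.
rewrite (comp_cong_r (assoc_nat _ _ _)) runit_inv_triangle -!tenshr_comp -!comp_assoc.
by rewrite alg_mul1l lunit_invK tensh_id comp_idr.
Qed.

(** In elements, xr ⊗ 1 = x ⊗ φ(r) = (x ⊗ 1)φ(r). *)
Lemma ind_unit_act (X : right_module R) :
  ind_unit X ∘ ract X
  = act X ∘ (idm (induction_obj cq phi X) ⊠ phi) ∘ (ind_unit X ⊠ idm (R : C)).
Proof.
rewrite comp_assoc tensh_interchange -comp_assoc ind_act_unit.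
rewrite /ind_unit !comp_assoc runit_inv_nat (comp_cong_r (tensh_interchange _ _)).
rewrite (comp_cong_r (ind_map_balanced X)) comp_assoc (comp_cong_r (assoc_nat_r _ _ _)).
rewrite runit_inv_tensor -!tenshr_comp /restr_lact comp_assoc -(comp_assoc (phi ⊠ _)).
by rewrite -tensh_interchange -!comp_assoc alg_mul1r runit_nat comp_assoc runit_invK comp_idr.
Qed.

Lemma ind_unit_nat (X Y : right_module R) (f : right_module_hom X Y) :
  rmod_hom (fmap ind f) ∘ ind_unit X = ind_unit Y ∘ f.
Proof.
rewrite /ind_unit -!comp_assoc ind_fmapE !comp_assoc runit_inv_nat.
by rewrite (comp_cong_r (tensh_interchange _ _)).
Qed.

Section ToFunctor.
Variable E : hom S R.
Hypotheses (left_E : left_linear phi E) (right_E : right_linear phi E).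

(** Left linearity of [E] enters here: (xr)E(s) = x(rE(s)) = xE(φ(r)s). *)
Lemma ind_counit_balanced (X : right_module R) :
  (ract X ∘ (idm (X : C) ⊠ E)) ∘ tensor_over_l X (restr_left_module phi)
  = (ract X ∘ (idm (X : C) ⊠ E)) ∘ tensor_over_r X (restr_left_module phi).
Proof.
rewrite /tensor_over_l /tensor_over_r /= !comp_assoc tensh_interchange.
rewrite -!comp_assoc ractA !comp_assoc assoc_nat_r; congr (_ ∘ _).
by rewrite -!comp_assoc -!tenshr_comp left_E.
Qed.

(** Not the counit of the induction/restriction adjunction: this map goes from X ⊗_R S back to [X],
    opposite to [ind_unit]. *)
Definition ind_counit (X : right_module R) : hom (induction_obj cq phi X) X :=
  coeq_desc (tensor_over_mapP cq X (restr_left_module phi)) (ind_counit_balanced X).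

Lemma ind_counitE (X : right_module R) :
  ind_counit X ∘ q X = ract X ∘ (idm (X : C) ⊠ E).
Proof. exact: coeq_descE. Qed.

(** Right linearity of [E] enters here: xE(sφ(r)) = xE(s)r. *)
Lemma ind_counit_act (X : right_module R) :
  ind_counit X ∘ (act X ∘ (idm (induction_obj cq phi X) ⊠ phi))
  = ract X ∘ (ind_counit X ⊠ idm (R : C)).
Proof.
apply: (ind_mapS_epi (X := X)).
rewrite !comp_assoc -tenshl_comp ind_counitE tenshl_comp tensh_interchange.
rewrite -(comp_assoc (ract X)) ractA -(comp_assoc (act X)) ind_actE !comp_assoc.
rewrite (comp_cong_r (ind_counitE X)) assoc_nat_r assoc_nat.
congr (_ ∘ _); rewrite -!comp_assoc -!tenshr_comp.
by rewrite comp_assoc right_E.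
Qed.

Lemma ind_counit_nat (X Y : right_module R) (f : right_module_hom X Y) :
  ind_counit Y ∘ rmod_hom (fmap ind f) = f ∘ ind_counit X.
Proof.
apply: (ind_map_epi (X := X)).
rewrite !comp_assoc ind_fmapE (comp_cong_r (ind_counitE Y)) ind_counitE.
by rewrite tensh_interchange -!comp_assoc -rmod_hom_act.
Qed.

(** In elements, xE(s) ⊗ s' = x ⊗ φ(E(s))s'. *)
Lemma ind_counit_mapS (X : right_module R) :
  q X ∘ ((ind_counit X ⊠ idm (S : C)) ∘ (q X ⊠ idm (S : C)))
  = q X ∘ ((idm (X : C) ⊠ (restr_lact phi ∘ (E ⊠ idm (S : C)))) ∘ assoc (X : C) S S).
Proof.
rewrite -tenshl_comp ind_counitE tenshl_comp (comp_cong_r (ind_map_balanced X)).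
by rewrite comp_assoc assoc_nat (tenshr_comp _ (restr_lact phi)) !comp_assoc.
Qed.

Lemma pullback_act (X Y : right_module R) (g : right_module_hom (ind X) (ind Y)) :
  (ind_counit Y ∘ (g ∘ ind_unit X)) ∘ ract X
  = ract Y ∘ ((ind_counit Y ∘ (g ∘ ind_unit X)) ⊠ idm (R : C)).
Proof.
rewrite (comp_assoc (ind_counit Y)) (comp_assoc (rmod_hom g)) ind_unit_act.
rewrite (tenshl_comp _ (ind_counit Y)) (tenshl_comp _ (rmod_hom g)).
rewrite -(comp_assoc (ract Y)) -ind_counit_act !(comp_assoc (ind_counit Y)).
rewrite (comp_assoc (act X)) (comp_cong_r (rmod_hom_act g)) (comp_assoc (act Y)).
by rewrite (comp_cong_r (tensh_interchange _ _)).
Qed.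

Definition pullback (X Y : right_modules R) (g : hom (ind X) (ind Y)) : hom X Y :=
  @RightModuleHom C R X Y _ (pullback_act g).

Lemma pullback_natural : hom_natural pullback.
Proof.
move=> X X' Y Y' h k f; apply: right_module_hom_eq => /=.
rewrite !comp_assoc (ind_unit_nat h) (comp_cong_r (ind_counit_nat k)).
by rewrite /ind_unit !comp_assoc.
Qed.

Lemma ind_counit_unit (X : right_module R) :
  ind_counit X ∘ ind_unit X
  = ract X ∘ ((idm (X : C) ⊠ (E ∘ alg_one S)) ∘ runit_inv (X : C)).
Proof.
by rewrite /ind_unit -!comp_assoc ind_counitE !comp_assoc tenshr_comp comp_assoc.
Qed.

(** By naturality of [ind_counit]. With [ind_counit_unit] the result is x ↦ f(xE(1)), so only the
    element E(1) matters on morphisms in the image of [ind]. *)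
Lemma pullback_fmap (X Y : right_modules R) (f : hom X Y) :
  rmod_hom (pullback (fmap ind f)) = rmod_hom f ∘ (ind_counit X ∘ ind_unit X).
Proof. by rewrite /= -comp_assoc (ind_counit_nat f) comp_assoc. Qed.

(** Here E(1) = E(φ(1)) = 1. *)
Lemma pullback_retraction :
  E ∘ phi = idm (R : C) ->
  forall (X Y : right_modules R) (f : hom X Y), pullback (fmap ind f) = f.
Proof.
move=> Ephi X Y f; apply: right_module_hom_eq.
rewrite pullback_fmap ind_counit_unit -(alg_hom_one phi) -(comp_assoc E) Ephi.
by rewrite comp_idl -(comp_assoc (ract X)) ract1 runit_invK comp_idr.
Qed.

(** Here only φ(E(1)) = 1 is available, which suffices after induction: xE(1) ⊗ s = x ⊗ φ(E(1))s = x
    ⊗ s. *)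
Lemma pullback_weak :
  phi ∘ E ∘ phi = phi ->
  forall (X Y : right_modules R) (f : hom X Y),
    fmap ind (pullback (fmap ind f)) = fmap ind f.
Proof.
move=> phiE X Y f; apply: right_module_hom_eq.
have one_E : phi ∘ (E ∘ alg_one S) = alg_one S.
  by rewrite -(alg_hom_one phi) -!comp_assoc phiE.
apply: (ind_map_epi (X := X)).
rewrite !ind_fmapE pullback_fmap tenshl_comp -comp_assoc -ind_fmapE comp_assoc.
congr (_ ∘ _).
rewrite ind_counit_unit !tenshl_comp (comp_cong_r (ind_map_balanced X)) comp_assoc.
rewrite (comp_cong_r (assoc_nat _ _ _)) runit_inv_triangle -!tenshr_comp.
rewrite -comp_assoc /restr_lact !(comp_assoc (alg_mul S)) -tenshl_comp one_E.
by rewrite -comp_assoc alg_mul1l lunit_invK tensh_id comp_idr.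
Qed.

(** When φ E = id, yE(s) ⊗ s' = y ⊗ ss', so [ind_counit] tensored with [S] becomes the action
    ([mapS]). The induced map then sends x ⊗ s to g(x ⊗ 1)s = g(x ⊗ s). *)
Lemma pullback_section :
  phi ∘ E = idm (S : C) ->
  forall (X Y : right_modules R) (g : hom (ind X) (ind Y)), fmap ind (pullback g) = g.
Proof.
move=> phiE X Y g; apply: right_module_hom_eq.
have mapS : q Y ∘ (ind_counit Y ⊠ idm (S : C)) = act Y.
  apply: (ind_mapS_epi (X := Y)).
  rewrite comp_assoc ind_counit_mapS /restr_lact comp_assoc -tenshl_comp phiE tensh_id.
  by rewrite comp_idr ind_actE.
apply: (ind_map_epi (X := X)).
rewrite ind_fmapE /= (tenshl_comp _ (ind_counit Y)) (tenshl_comp _ (rmod_hom g)) -comp_assoc.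
by rewrite mapS -comp_assoc -(rmod_hom_act g) comp_assoc ind_act_unit.
Qed.

End ToFunctor.

(** * The three properties of induction in terms of [E] *)

Definition bimodule_splitting (cond : hom S R -> Prop) : Prop :=
  exists E : hom S R, left_linear phi E /\ right_linear phi E /\ cond E.

Lemma semiseparable_of_splitting :
  bimodule_splitting (fun E => phi ∘ E ∘ phi = phi) -> semiseparable ind.
Proof.
case=> E [lE [rE EK]]; exists (pullback lE rE).
by split; [exact: pullback_natural|exact: pullback_weak].
Qed.

Lemma splitting_of_semiseparable :
  left_tensor_generator (munit C) ->
  semiseparable ind -> bimodule_splitting (fun E => phi ∘ E ∘ phi = phi).
Proof.
move=> gen [P [natP PK]]; exists (splitting P).
split; first exact: splitting_left_linear.
split; first exact: splitting_right_linear.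
exact: splitting_weak.
Qed.

Lemma separable_of_splitting :
  bimodule_splitting (fun E => E ∘ phi = idm (R : C)) -> separable ind.
Proof.
case=> E [lE [rE EK]]; exists (pullback lE rE).
by split; [exact: pullback_natural|exact: pullback_retraction].
Qed.

Lemma splitting_of_separable :
  left_tensor_generator (munit C) ->
  separable ind -> bimodule_splitting (fun E => E ∘ phi = idm (R : C)).
Proof.
move=> gen [P [natP PK]]; exists (splitting P).
split; first exact: splitting_left_linear.
split; first exact: splitting_right_linear.
exact: splitting_retraction.
Qed.

Lemma naturally_full_of_splitting :
  bimodule_splitting (fun E => phi ∘ E = idm (S : C)) -> naturally_full ind.
Proof.
case=> E [lE [rE EK]]; exists (pullback lE rE).
by split; [exact: pullback_natural|exact: pullback_section].
Qed.

Lemma splitting_of_naturally_full :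
  left_tensor_generator (munit C) ->
  naturally_full ind -> bimodule_splitting (fun E => phi ∘ E = idm (S : C)).
Proof.
move=> gen [P [natP PK]]; exists (splitting P).
split; first exact: splitting_left_linear.
split; first exact: splitting_right_linear.
exact: splitting_section.
Qed.

End InductionTheory.

(** * Transport of [E] along a lax monoidal functor *)

Section LaxTransfer.
Variables (C D : monoidal_category) (F : lax_monoidal_functor C D).
Variables (R S : algebra C) (phi : algebra_hom R S).

(** Products with image morphisms become images under [F] precomposed with [lax2]. Linearity of
    [fmap F E] is thus [F] of the linearity of [E], precomposed with [lax2]. *)
Lemma lax_mul_l (X : C) (B : algebra C) (f : hom X B) :
  lax_mul F B ∘ (fmap F f ⊠ idm (F B)) = fmap F (alg_mul B ∘ (f ⊠ idm (B : C))) ∘ lax2 F X B.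
Proof. by rewrite /lax_mul -(fmap_id F B) comp_assoc lax2_nat fmap_comp comp_assoc. Qed.

Lemma lax_mul_r (X : C) (B : algebra C) (f : hom X B) :
  lax_mul F B ∘ (idm (F B) ⊠ fmap F f) = fmap F (alg_mul B ∘ (idm (B : C) ⊠ f)) ∘ lax2 F B X.
Proof. by rewrite /lax_mul -(fmap_id F B) comp_assoc lax2_nat fmap_comp comp_assoc. Qed.

Lemma lax_left_linear (E : hom S R) :
  left_linear phi E -> left_linear (lax_algebra_hom F phi) (fmap F E).
Proof.
rewrite /left_linear /restr_lact /= lax_mul_l lax_mul_r => <-.
by rewrite !fmap_comp !comp_assoc.
Qed.

Lemma lax_right_linear (E : hom S R) :
  right_linear phi E -> right_linear (lax_algebra_hom F phi) (fmap F E).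
Proof.
rewrite /right_linear /= lax_mul_l lax_mul_r => <-.
by rewrite !fmap_comp !comp_assoc.
Qed.

Section Reflection.
Hypotheses (faithfulF : faithful F) (epi_lax2 : forall X Y : C, epi (lax2 F X Y)).

(** Both sides are images under [F] precomposed with [lax2]: cancel the epimorphism, then use
    faithfulness. *)
Lemma reflect_left_linear (E : hom S R) :
  left_linear (lax_algebra_hom F phi) (fmap F E) -> left_linear phi E.
Proof.
rewrite /left_linear {1}/restr_lact /= lax_mul_l lax_mul_r -comp_assoc -fmap_comp.
by move/epi_lax2/faithfulF.
Qed.

Lemma reflect_right_linear (E : hom S R) :
  right_linear (lax_algebra_hom F phi) (fmap F E) -> right_linear phi E.
Proof.
rewrite /right_linear /= lax_mul_l lax_mul_r -comp_assoc -fmap_comp.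
by move/epi_lax2/faithfulF.
Qed.

End Reflection.

(** The conditions are parameters so that one argument serves all three properties. *)
Lemma lax_bimodule_splitting (cond : hom S R -> Prop) (cond' : hom (F S) (F R) -> Prop) :
  (forall E, cond E -> cond' (fmap F E)) ->
  bimodule_splitting phi cond -> bimodule_splitting (lax_algebra_hom F phi) cond'.
Proof.
move=> condF [E [lE [rE cE]]]; exists (fmap F E).
split; first exact: lax_left_linear.
by split; [exact: lax_right_linear|exact: condF].
Qed.

Lemma reflect_bimodule_splitting (cond : hom S R -> Prop) (cond' : hom (F S) (F R) -> Prop) :
  fully_faithful F -> (forall X Y : C, epi (lax2 F X Y)) ->
  (forall E, cond' (fmap F E) -> cond E) ->
  bimodule_splitting (lax_algebra_hom F phi) cond' -> bimodule_splitting phi cond.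
Proof.
move=> [fullF faithfulF] epi_lax2 condF [E' [lE [rE cE]]].
(* Fullness lifts the splitting of F(φ) to a morphism of [C]. *)
have [E defE] := fullF S R E'; subst E'; exists E.
split; first exact: reflect_left_linear.
by split; [exact: reflect_right_linear|exact: condF].
Qed.

End LaxTransfer.

Theorem proposition3p24
    (C D : monoidal_category)
    (cqC : coequalizers C) (cqD : coequalizers D)
    (cfC : forall X : C, coflat X) (cfD : forall X : D, coflat X)
    (genC : left_tensor_generator (munit C)) :
  (forall (F : lax_monoidal_functor C D)
      (R S : algebra C) (phi : algebra_hom R S),
    (semiseparable (induction cqC cfC phi) ->
       semiseparable (induction cqD cfD (lax_algebra_hom F phi))) /\
    (separable (induction cqC cfC phi) ->
       separable (induction cqD cfD (lax_algebra_hom F phi))) /\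
    (naturally_full (induction cqC cfC phi) ->
       naturally_full (induction cqD cfD (lax_algebra_hom F phi)))) /\
  (left_tensor_generator (munit D) ->
   forall F : lax_monoidal_functor C D,
    fully_faithful F ->
    (forall X Y : C, epi (lax2 F X Y)) ->
    forall (R S : algebra C) (phi : algebra_hom R S),
    (semiseparable (induction cqD cfD (lax_algebra_hom F phi)) ->
       semiseparable (induction cqC cfC phi)) /\
    (separable (induction cqD cfD (lax_algebra_hom F phi)) ->
       separable (induction cqC cfC phi)) /\
    (naturally_full (induction cqD cfD (lax_algebra_hom F phi)) ->
       naturally_full (induction cqC cfC phi))).
Proof.
split=> [F R S phi|genD F [fullF faithfulF] epiF R S phi].
- split; [|split].
  + move/(splitting_of_semiseparable genC) => spl; apply: semiseparable_of_splitting; move: spl.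
    apply: lax_bimodule_splitting => E /= EK.
    by rewrite -!fmap_comp EK.
  + move/(splitting_of_separable genC) => spl; apply: separable_of_splitting; move: spl.
    apply: lax_bimodule_splitting => E /= EK.
    by rewrite -fmap_comp EK fmap_id.
  + move/(splitting_of_naturally_full genC) => spl; apply: naturally_full_of_splitting; move: spl.
    apply: lax_bimodule_splitting => E /= EK.
    by rewrite -fmap_comp EK fmap_id.
- split; [|split].
  + move/(splitting_of_semiseparable genD) => spl; apply: semiseparable_of_splitting; move: spl.
    apply: reflect_bimodule_splitting => // E /=.
    by rewrite -!fmap_comp => /faithfulF.
  + move/(splitting_of_separable genD) => spl; apply: separable_of_splitting; move: spl.
    apply: reflect_bimodule_splitting => // E /=.
    (* The identity is rewritten as the image of an identity, so that faithfulness applies to both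
       sides. *)
    by rewrite -fmap_comp -fmap_id => /faithfulF.
  + move/(splitting_of_naturally_full genD) => spl; apply: naturally_full_of_splitting; move: spl.
    apply: reflect_bimodule_splitting => // E /=.
    by rewrite -fmap_comp -fmap_id => /faithfulF.
Qed.
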